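(* Let $a > b > 0$ be real numbers and let $A$ be a complex $n \times n$ matrix whose spectrum belongs to $$\mathcal{E}_e = \left\{\lambda \in \mathbb{C} : \frac{(\mathrm{Re}\,\lambda)^2}{a^2} + \frac{(\mathrm{Im}\,\lambda)^2}{b^2} > 1 \right\}.$$ Let $H = H^* > 0$ be a solution to $$H - \left(\frac{1}{2a^2}+\frac{1}{2b^2}\right) A^*HA - \left(\frac{1}{4a^2}-\frac{1}{4b^2}\right)\left(HA^2+(A^* )^2H\right) = -I.$$ If $B$ is a complex $n \times n$ matrix such that $$\|B\| < 2a^2(a^2 - b^2)^{-1} \left(\sqrt{\|A\|^2 + \left(\frac{a^2 - b^2}{2a^2}\right)\frac{b^2}{\|H\|}} - \|A\|\right),$$ then the spectrum of the matrix $A + B$ also belongs to $\mathcal{E}_e$.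
   Context: $M^*$ denotes the conjugate transpose of $M$, and $I$ is the $n\times n$ identity matrix. For a Hermitian matrix $M$, $M > 0$ means that $M$ is positive definite. $\|\cdot\|$ is the spectral norm of matrices, i.e. the operator norm induced by the Euclidean norm on $\mathbb{C}^n$. *)

(* Defs.v *)
From mathcomp Require Import all_boot all_order all_algebra.
From mathcomp Require Import complex classical_sets reals.
Set Implicit Arguments.
Unset Strict Implicit.
Unset Printing Implicit Defensive.

Import Order.TTheory GRing.Theory Num.Theory.

Local Open Scope classical_set_scope.
Local Open Scope ring_scope.
Local Open Scope complex_scope.
Local Open Scope sesquilinear_scope.

(* [M ^t*] is the library's conjugate transpose; [hermsymmx] means [M = M ^t*].
   In the order of [R[i]], [0 < z] means that [z] is real and positive. *)
Definition posdefmx (R : realType) (n : nat) (M : 'M[R[i]]_n) : Prop :=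
  M \is hermsymmx /\
  forall x : 'cV[R[i]]_n, x != 0 -> 0 < (x ^t* *m M *m x) 0 0.

Definition l2norm (R : realType) (n : nat) (x : 'cV[R[i]]_n) : R :=
  Num.sqrt (\sum_i (complex.Re (x i 0) ^+ 2 + complex.Im (x i 0) ^+ 2)).

(* The set is nonempty and bounded (finite dimension), so [sup] is a genuine
   supremum; for [n = 0] it is [0]. *)
Definition opnorm (R : realType) (n : nat) (M : 'M[R[i]]_n) : R :=
  sup [set l2norm (M *m x) | x in [set x : 'cV[R[i]]_n | l2norm x <= 1]].

(* The library's [eigenvalue] is phrased with row eigenvectors [v *m M = l *: v];
   for square matrices these are the roots of the characteristic polynomial
   ([eigenvalue_root_char]), hence the usual spectrum. *)
Definition spectrum (R : realType) (n : nat) (M : 'M[R[i]]_n) : set R[i] :=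
  [set l | eigenvalue M l].

Definition ellipse_ext (R : realType) (a b : R) : set R[i] :=
  [set l | complex.Re l ^+ 2 / a ^+ 2 + complex.Im l ^+ 2 / b ^+ 2 > 1].

(* Main.v *)
(** Let [C = A + B], [C x = l x], [q] the form of [H], and write the left-hand side
of the equation as [H - c1 A'HA - c2 (HA^2 + A'^2 H)], where [A'] is the conjugate
transpose.  Evaluating it, with [C] in place of [A], at the right eigenvector [x] gives
[(1 - (Re l)^2/a^2 - (Im l)^2/b^2) q(x,x)], so it suffices that this value is
negative.  It differs from [-|x|^2] by terms containing [B]; all are estimated by
Cauchy-Schwarz except [- c1 q(Bx,Bx)], which is nonpositive and is dropped.  With
[k = (a^2 - b^2)/(2 a^2)] one has [c1 = (1 - k)/b^2] and [2 c2 = - k/b^2], and the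
resulting requirement [|H| (2 |A||B| + k |B|^2) < b^2] is the quadratic inequality
in [|B|] solved by the hypothesis. *)
Require Import Defs.
From mathcomp Require Import all_boot all_order all_algebra.
From mathcomp Require Import complex classical_sets reals.
From mathcomp Require Import ring lra.
Import Order.TTheory GRing.Theory Num.Theory.
Local Open Scope classical_set_scope.
Local Open Scope ring_scope.
Local Open Scope complex_scope.
Local Open Scope sesquilinear_scope.

(** * Euclidean geometry of complex column vectors and the operator norm *)

Section Euclidean.
Set Implicit Arguments.
Unset Strict Implicit.

Variables (R : realType) (n : nat).
Implicit Types (x y z : 'cV[R[i]]_n) (M : 'M[R[i]]_n).

(** The real inner product of C^n seen as R^(2n); it is symmetric and keeps all estimates in [R]. *)
Definition rdot y z : R := complex.Re ((y ^t* *m z) 0 0).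

Lemma l2norm_ge0 x : 0 <= l2norm x.
Proof. exact: sqrtr_ge0. Qed.

Lemma l2normE x : ((l2norm x) ^+ 2)%:C = (x ^t* *m x) 0 0.
Proof.
rewrite sqr_sqrtr; last by apply: sumr_ge0 => i _; rewrite addr_ge0 ?sqr_ge0.
rewrite mxE rmorph_sum; apply: eq_bigr => i _.
rewrite !mxE mulrC -normCK; exact: add_Re2_Im2.
Qed.

Lemma rdotC y z : rdot y z = rdot z y.
Proof.
rewrite /rdot; set u := _ *m z; set v := _ *m y.
have -> : u = v ^t* by rewrite trmx_mul map_mxM /= trmxCK.
by rewrite !mxE; case: (\sum__ _).
Qed.

Lemma rdotDr x y z : rdot x (y + z) = rdot x y + rdot x z.
Proof. by rewrite /rdot mulmxDr mxE raddfD. Qed.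

Lemma rdotNr x y : rdot x (- y) = - rdot x y.
Proof. by rewrite /rdot mulmxN mxE raddfN. Qed.

Lemma rdotZr (c : R) x y : rdot x (c%:C *: y) = c * rdot x y.
Proof.
by rewrite /rdot -scalemxAr mxE; case: (_ 0 0) => u v /=; rewrite mul0r subr0.
Qed.

Lemma rdot_comb x (c d : R) M N P :
  rdot x ((M - c%:C *: N - d%:C *: P) *m x)
  = rdot x (M *m x) - c * rdot x (N *m x) - d * rdot x (P *m x).
Proof.
rewrite mulmxBl rdotDr rdotNr -scalemxAl rdotZr.
by rewrite mulmxBl rdotDr rdotNr -scalemxAl rdotZr.
Qed.

Lemma rdotxx x : rdot x x = l2norm x ^+ 2.
Proof. by rewrite /rdot -l2normE. Qed.

Lemma rdot_mulmxl M y z : rdot (M *m y) z = rdot y (M ^t* *m z).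
Proof. by rewrite /rdot trmx_mul map_mxM /= mulmxA. Qed.

(** Cauchy-Schwarz for [dotmx], which pairs row vectors, hence the adjoints; the imaginary part is
    then discarded. *)
Lemma normr_rdot_le y z : `|rdot y z| <= l2norm y * l2norm z.
Proof.
rewrite -ler_sqr ?nnegrE ?normr_ge0 ?mulr_ge0 ?l2norm_ge0 //.
rewrite real_normK ?num_real //.
have [] := @CauchySchwarz _ _ (@dotmx R[i] n) (y ^t*) (z ^t*).
set a := `|_|; set b := _ * _ => h _; move: h.
have -> : a = `|(y ^t* *m z) 0 0|.
  by rewrite /a; have := dotmxE (y ^t*) (z ^t*); rewrite trmxCK => <-.
have -> : b = (l2norm y ^+ 2 * l2norm z ^+ 2)%:C.
  rewrite rmorphM /= !l2normE /b; congr (_ * _).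
    by have := dotmxE (y ^t*) (y ^t*); rewrite trmxCK => <-.
  by have := dotmxE (z ^t*) (z ^t*); rewrite trmxCK => <-.
rewrite -add_Re2_Im2 lecR exprMn; apply: le_trans.
by rewrite lerDl sqr_ge0.
Qed.

Lemma l2norm_gt0 x : x != 0 -> 0 < l2norm x.
Proof.
move=> x0; rewrite sqrtr_gt0 lt0r sumr_ge0 ?andbT; last first.
  by move=> i _; rewrite addr_ge0 ?sqr_ge0.
apply: contra x0 => /eqP /psumr_eq0P h; apply/eqP/colP => i; rewrite mxE.
have /eqP := h (fun j _ => addr_ge0 (sqr_ge0 _) (sqr_ge0 _)) i isT.
rewrite paddr_eq0 ?sqr_ge0 // !sqrf_eq0 => /andP[hr hi].
by apply/eqP; rewrite eq_complex hr hi.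
Qed.

Lemma l2normZ (c : R) x : 0 <= c -> l2norm (c%:C *: x) = c * l2norm x.
Proof.
move=> c0; rewrite -[c in RHS](ger0_norm c0) -sqrtr_sqr -sqrtrM ?sqr_ge0 //.
congr Num.sqrt; rewrite mulr_sumr; apply: eq_bigr => i _; rewrite mxE.
by case: (x i 0) => u v /=; ring.
Qed.

Lemma l2norm0 : l2norm (0 : 'cV[R[i]]_n) = 0.
Proof. by have := @l2normZ 0 0 (lexx 0); rewrite scaler0 mul0r. Qed.

(** Up to sign, the real and imaginary parts of each entry of [M *m x] are inner products of [x]
    with fixed vectors, so Cauchy-Schwarz bounds them on the unit ball. *)
Lemma has_ubound_opnorm M :
  has_ubound [set l2norm (M *m x) | x in [set x | l2norm x <= 1]].
Proof.
pose r i := (row i M) ^t*.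
(* [Im z = - Re ('i z)] turns imaginary parts into values of [rdot]. *)
pose r' i := ('i *: row i M) ^t*.
exists (Num.sqrt (\sum_i (l2norm (r i) ^+ 2 + l2norm (r' i) ^+ 2))).
move=> _ [x /= x1 <-]; apply: ler_wsqrtr; apply: ler_sum => i _.
have le1 y : rdot y x ^+ 2 <= l2norm y ^+ 2.
  rewrite -[leLHS]real_normK ?num_real // ler_sqr ?nnegrE ?l2norm_ge0 //.
  by rewrite (le_trans (normr_rdot_le _ _)) // ler_piMr ?l2norm_ge0.
have -> : complex.Re ((M *m x) i 0) = rdot (r i) x.
  by rewrite /rdot /r trmxCK -row_mul [in RHS]mxE.
have -> : complex.Im ((M *m x) i 0) = - rdot (r' i) x.
  rewrite /rdot /r' trmxCK -scalemxAl -row_mul.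
  rewrite [in RHS]mxE [X in 'i * X]mxE.
  by case: ((M *m x) i 0) => u v /=; ring.
by rewrite sqrrN lerD.
Qed.

Lemma l2norm_mul_le M x : l2norm (M *m x) <= opnorm M * l2norm x.
Proof.
have [->|/l2norm_gt0 x0] := eqVneq x 0; first by rewrite mulmx0 l2norm0 mulr0.
(* Scaling [x] to norm 1 puts it in the unit ball over which the supremum is taken. *)
rewrite -ler_pdivrMr // mulrC -l2normZ ?invr_ge0 ?(ltW x0) // scalemxAr.
apply: ub_le_sup; first exact: has_ubound_opnorm.
exists ((l2norm x)^-1%:C *: x) => //=.
by rewrite l2normZ ?invr_ge0 ?(ltW x0) // mulVf ?gt_eqF.
Qed.

Lemma opnorm_ge0 M : 0 <= opnorm M.
Proof.
apply: ub_le_sup; first exact: has_ubound_opnorm.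
by exists 0; rewrite ?mulmx0 /= l2norm0.
Qed.

Lemma l2norm_mul_le_scale M y (c s : R) :
  l2norm y <= c * s -> l2norm (M *m y) <= opnorm M * c * s.
Proof.
move=> le_c; apply: le_trans (l2norm_mul_le _ _) _.
by rewrite -mulrA ler_wpM2l ?opnorm_ge0.
Qed.

End Euclidean.

(** A matrix and its transpose share their characteristic polynomial; this trades row eigenvectors
    for the columns on which the form of [H] is evaluated. *)
Lemma eigenvalue_colP (F : fieldType) n (M : 'M[F]_n) (l : F) :
  reflect (exists2 x : 'cV_n, M *m x = l *: x & x != 0) (eigenvalue M l).
Proof.
have -> : eigenvalue M l = eigenvalue M^T l.
  rewrite !eigenvalue_root_char /char_poly -det_tr; congr (root (\det _) l).
  by apply/matrixP => i j; rewrite !mxE eq_sym.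
apply: (iffP eigenvalueP) => -[x h x0]; exists x^T;
  rewrite ?trmx_eq0 // -[LHS]trmxK trmx_mul.
- by rewrite trmxK h linearZ.
- by rewrite !trmxK h linearZ.
Qed.

(** * The form of [H] and its values at an eigenvector of [A + B] *)

Section HermitianForm.
Set Implicit Arguments.
Unset Strict Implicit.

Variables (R : realType) (n : nat) (H : 'M[R[i]]_n).
Hypothesis (hH : posdefmx H).
Implicit Types (x y z : 'cV[R[i]]_n) (c : R[i]).

Definition qform y z : R := rdot y (H *m z).

Lemma qformDr x y z : qform x (y + z) = qform x y + qform x z.
Proof. by rewrite /qform mulmxDr rdotDr. Qed.

Lemma qformC y z : qform y z = qform z y.
Proof.
have HH : H ^t* = H.
  by case: hH => /is_hermitianmxP h _; rewrite {2}h expr0 scale1r.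
by rewrite /qform rdotC rdot_mulmxl HH.
Qed.

Lemma qformDl x y z : qform (x + y) z = qform x z + qform y z.
Proof. by rewrite qformC qformDr !(qformC z). Qed.

Lemma qform_gt0 x : x != 0 -> 0 < qform x x.
Proof.
case: hH => _ h /h; rewrite ltcE => /andP[_]; rewrite /qform /rdot mulmxA; exact.
Qed.

Lemma qform_ge0 x : 0 <= qform x x.
Proof.
have [->|/qform_gt0/ltW//] := eqVneq x 0.
by rewrite /qform /rdot !mulmx0 mxE.
Qed.

(** Only [Re c] survives because [x ^t* *m H *m x] is real. *)
Lemma qformZr c x : qform x (c *: x) = complex.Re c * qform x x.
Proof.
have [->|x0] := eqVneq x 0.
  by rewrite /qform scaler0 /rdot !mulmx0 mxE mulr0.
case: hH => _ /(_ x x0); rewrite ltcE => /andP[/eqP im _].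
rewrite /qform /rdot -!scalemxAr mxE mulmxA.
move: im; case: (_ 0 0) => u v /= ->; case: c => p q /=; ring.
Qed.

Lemma qformZZ c x :
  qform (c *: x) (c *: x) = (complex.Re c ^+ 2 + complex.Im c ^+ 2) * qform x x.
Proof.
transitivity (qform x ((complex.Re c ^+ 2 + complex.Im c ^+ 2)%:C *: x)).
  rewrite add_Re2_Im2 normCK /qform /rdot linearZ /= map_mxZ -scalemxAl.
  by rewrite -!scalemxAr scalerA [in RHS]mulrC.
by rewrite qformZr.
Qed.

Lemma normr_qform_le y z : `|qform y z| <= opnorm H * (l2norm y * l2norm z).
Proof.
apply: le_trans (normr_rdot_le _ _) _.
by rewrite mulrCA ler_wpM2l ?l2norm_ge0 // l2norm_mul_le.
Qed.

Lemma normr_qform_le_scale y z (c d s : R) :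
  l2norm y <= c * s -> l2norm z <= d * s ->
  `|qform y z| <= opnorm H * (c * d * s ^+ 2).
Proof.
move=> le_c le_d; apply: le_trans (normr_qform_le _ _) _.
rewrite ler_wpM2l ?opnorm_ge0 // expr2 mulrACA.
exact: ler_pM (l2norm_ge0 _) (l2norm_ge0 _) le_c le_d.
Qed.

Lemma qform_perturbed_eigenvector (A B : 'M[R[i]]_n) (c1 c2 : R) (l : R[i]) x :
  H - c1%:C *: (A ^t* *m H *m A)
    - c2%:C *: (H *m (A *m A) + (A ^t* *m A ^t* ) *m H) = - 1%:M ->
  (A + B) *m x = l *: x ->
  (1 - (c1 * (complex.Re l ^+ 2 + complex.Im l ^+ 2)
        + 2 * c2 * complex.Re (l ^+ 2))) * qform x x
  = - l2norm x ^+ 2 - c1 * (2 * qform (A *m x) (B *m x) + qform (B *m x) (B *m x))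
    - 2 * c2 * qform x (A *m (B *m x) + B *m (A *m x + B *m x)).
Proof.
move=> hHeq hx; set p := A *m x; set w := B *m x.
have pw : p + w = l *: x by rewrite -hx mulmxDl.
have ppw : A *m p + (A *m w + B *m (p + w)) = (l ^+ 2) *: x.
  by rewrite addrA -mulmxDr -mulmxDl pw -scalemxAr hx scalerA.
(* The equation evaluated at [x]: [H A^2] and its adjoint have the same real part there, whence the
   factor 2. *)
have eqA : qform x x - c1 * qform p p - 2 * c2 * qform x (A *m p)
           = - l2norm x ^+ 2.
  have := congr1 (fun M => rdot x (M *m x)) hHeq.
  rewrite rdot_comb mulNmx rdotNr mul1mx rdotxx mulmxDl rdotDr.
  rewrite -![in X in X = _]mulmxA -3!rdot_mulmxl -/p.
  rewrite -/(qform x x) -/(qform p p) -/(qform x _) -/(qform _ x).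
  rewrite (qformC _ x) => <-.
  by move: (qform x x) (qform p p) (qform x _) => *; ring.
have e1 := qformZZ l x; have e2 := qformZr (l ^+ 2) x.
(* Expanding [q(l x, l x)] along [p + w] and [q(x, l^2 x)] along [ppw] isolates the terms containing
   [B]. *)
rewrite -pw qformDl !qformDr (qformC w p) in e1.
rewrite -ppw qformDr in e2.
rewrite -eqA; move: e1 e2; clear.
move: (complex.Re l ^+ 2 + _) (complex.Re (l ^+ 2)) => L2 L'.
move: (qform x x) (qform p p) (qform p w) (qform w w).
move: (qform x (A *m p)) (qform x _) => qAp qr q qpp qpw qww e1 e2.
transitivity (q - c1 * (L2 * q) - 2 * c2 * (L' * q)); first by ring.
by rewrite -e1 -e2; ring.
Qed.

End HermitianForm.

(** * Coefficients of the ellipse and scalar estimates *)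

Section RealInequalities.
Set Implicit Arguments.
Unset Strict Implicit.

Lemma ellipse_coef (R : realFieldType) (a b : R) : 0 < b -> b < a ->
  exists k : R, [/\ k = (a ^+ 2 - b ^+ 2) / (2 * a ^+ 2), 0 < k, k < 1,
    1 / (2 * a ^+ 2) + 1 / (2 * b ^+ 2) = (1 - k) / b ^+ 2
    & 1 / (4 * a ^+ 2) - 1 / (4 * b ^+ 2) = - (k / (2 * b ^+ 2))].
Proof.
move=> b0 ab; have a0 := lt_trans b0 ab.
have a2 : 0 < 2 * a ^+ 2 by rewrite mulr_gt0 ?exprn_gt0.
have ab2 : b ^+ 2 < a ^+ 2 by rewrite ltr_sqr ?nnegrE ?ltW.
have b2 : 0 < b ^+ 2 by rewrite exprn_gt0.
exists ((a ^+ 2 - b ^+ 2) / (2 * a ^+ 2)); split=> //.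
- by rewrite divr_gt0 ?subr_gt0.
- by rewrite ltr_pdivrMr // mul1r; lra.
- by field; rewrite !gt_eqF.
- by field; rewrite !gt_eqF.
Qed.

(** The squares of [Re l] and [Im l] are half the sum and half the difference of [|l|^2] and
    [Re (l^2)]. *)
Lemma ellipse_eqE (R : realType) (a b : R) (l : R[i]) : a != 0 -> b != 0 ->
  complex.Re l ^+ 2 / a ^+ 2 + complex.Im l ^+ 2 / b ^+ 2
  = (1 / (2 * a ^+ 2) + 1 / (2 * b ^+ 2)) * (complex.Re l ^+ 2 + complex.Im l ^+ 2)
    + 2 * (1 / (4 * a ^+ 2) - 1 / (4 * b ^+ 2)) * complex.Re (l ^+ 2).
Proof. by case: l => u v a0 b0 /=; field; rewrite a0 b0. Qed.

(** The bound on [be] is the larger root of [k X^2 + 2 al X = t]; the proof completes the square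
    after multiplying by [k]. *)
Lemma quadratic_lt_of_lt_sqrt (R : rcfType) (k al be t : R) :
  0 < k -> 0 <= al -> 0 <= be -> 0 <= t ->
  be < k^-1 * (Num.sqrt (al ^+ 2 + k * t) - al) ->
  2 * al * be + k * be ^+ 2 < t.
Proof.
move=> k0 al0 be0 t0; rewrite mulrC ltr_pdivlMr // ltrBrDr => lt_sqrt.
have r0 : 0 <= al ^+ 2 + k * t by rewrite addr_ge0 ?sqr_ge0 ?mulr_ge0 // ltW.
have l0 : 0 <= be * k + al by rewrite addr_ge0 ?mulr_ge0 // ltW.
move: lt_sqrt; rewrite -ltr_sqr ?nnegrE ?sqrtr_ge0 // sqr_sqrtr //.
have -> : (be * k + al) ^+ 2 = al ^+ 2 + k * (2 * al * be + k * be ^+ 2).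
  by ring.
by rewrite ltrD2l ltr_pM2l.
Qed.

(* Instantiated with [qpw = q(Ax,Bx)], [qww = q(Bx,Bx)], [q1 = q(x,ABx)],
   [q2 = q(x,BAx)], [q3 = q(x,BBx)], [s2 = |x|^2], where [q] is the form of [H]. *)
Lemma perturbation_lt0 (R : realFieldType) (k b2 h al be s2 qpw qww q1 q2 q3 : R) :
  0 < k -> k < 1 -> 0 < b2 -> 0 < s2 ->
  h * (2 * al * be + k * be ^+ 2) < b2 ->
  - qpw <= h * (al * be * s2) -> 0 <= qww ->
  q1 <= h * (al * be * s2) -> q2 <= h * (be * al * s2) ->
  q3 <= h * (be * be * s2) ->
  - s2 - (1 - k) / b2 * (2 * qpw + qww) + k / b2 * (q1 + (q2 + q3)) < 0.
Proof.
move=> k0 k1 b0 s0 small le_pw ww0 le1 le2 le3.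
rewrite -(pmulr_llt0 _ b0).
have -> : (- s2 - (1 - k) / b2 * (2 * qpw + qww) + k / b2 * (q1 + (q2 + q3))) * b2
   = - (s2 * b2) - (1 - k) * (2 * qpw + qww) + k * (q1 + (q2 + q3)).
  by field; rewrite gt_eqF.
have kV : 0 <= 1 - k by rewrite subr_ge0 ltW.
have := ler_wpM2l kV le_pw; have := mulr_ge0 kV ww0.
have := ler_wpM2l (ltW k0) le1; have := ler_wpM2l (ltW k0) le2.
have := ler_wpM2l (ltW k0) le3.
(* Taken with weights [2 (1 - k)] for [- qpw] and [k] for each of [q1], [q2], [q3], the upper bounds
   add up to exactly this left-hand side. *)
have : s2 * (h * (2 * al * be + k * be ^+ 2)) < s2 * b2 by rewrite ltr_pM2l.
lra.
Qed.

End RealInequalities.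

Theorem corollary1 (R : realType) (n : nat) (a b : R) (A B H : 'M[R[i]]_n)
  (hb : 0 < b) (hab : b < a)
  (hA : spectrum A `<=` ellipse_ext a b)
  (hH : posdefmx H)
  (hHeq : H
          - (1 / (2 * a ^+ 2) + 1 / (2 * b ^+ 2))%:C *: (A ^t* *m H *m A)
          - (1 / (4 * a ^+ 2) - 1 / (4 * b ^+ 2))%:C
              *: (H *m (A *m A) + (A ^t* *m A ^t* ) *m H)
          = - 1%:M)
  (hB : opnorm B <
        2 * a ^+ 2 * (a ^+ 2 - b ^+ 2)^-1 *
          (Num.sqrt (opnorm A ^+ 2
                     + (a ^+ 2 - b ^+ 2) / (2 * a ^+ 2) * (b ^+ 2 / opnorm H))
           - opnorm A)) :
  spectrum (A + B) `<=` ellipse_ext a b.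
Proof.
move=> l /eigenvalue_colP[x hx x0] {hA}.
have a0 := lt_trans hb hab.
have eqC := qform_perturbed_eigenvector hH hHeq hx.
rewrite -ellipse_eqE ?gt_eqF // in eqC.
rewrite /ellipse_ext /= -subr_lt0 -(pmulr_llt0 _ (qform_gt0 hH x0)) {}eqC {hHeq hx}.
have s0 : 0 < l2norm x := l2norm_gt0 x0.
(* The hypothesis on [B] divides by [opnorm H], which is positive since
   [0 < q(x,x) <= |H| |x|^2]. *)
have h0 : 0 < opnorm H.
  have := normr_qform_le H x x; move/(le_trans (ler_norm _)).
  by move/(lt_le_trans (qform_gt0 hH x0)); rewrite pmulr_lgt0 // mulr_gt0.
have [k [kE k0 k1 -> ->]] := ellipse_coef hb hab.
have b2 : 0 < b ^+ 2 by rewrite exprn_gt0.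
have -> : 2 * - (k / (2 * b ^+ 2)) = - (k / b ^+ 2).
  by field; rewrite gt_eqF.
have small : opnorm H * (2 * opnorm A * opnorm B + k * opnorm B ^+ 2) < b ^+ 2.
  rewrite mulrC -ltr_pdivlMr //.
  apply: (quadratic_lt_of_lt_sqrt k0 (opnorm_ge0 A) (opnorm_ge0 B)).
    by rewrite divr_ge0 // ltW.
  (* The factor [2 a^2 / (a^2 - b^2)] of the hypothesis is [k^-1]. *)
  by rewrite kE invf_div.
rewrite mulNr opprK mulmxDr !qformDr {hB kE}.
have lx : l2norm x <= 1 * l2norm x by rewrite mul1r.
(* One bound for the three terms [q(x,ABx)], [q(x,BAx)] and [q(x,BBx)]. *)
have qx_le M y c : l2norm y <= c * l2norm x ->
    qform H x (M *m y) <= opnorm H * (opnorm M * c * l2norm x ^+ 2).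
  move=> /(l2norm_mul_le_scale M)/(normr_qform_le_scale H lx); rewrite mul1r.
  exact: le_trans (ler_norm _).
have lA := l2norm_mul_le A x; have lB := l2norm_mul_le B x.
apply: (perturbation_lt0 k0 k1 b2 _ small).
- by rewrite exprn_gt0.
- by apply: le_trans _ (normr_qform_le_scale H lA lB); rewrite -normrN ler_norm.
- exact: qform_ge0.
- exact: qx_le.
- exact: qx_le.
- exact: qx_le.
Qed.
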